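(* Let $K$ be a compact Hausdorff topological space. Then $C(K)$ has the weak-DD2P if and only if $K'$ is an infinite set (equivalently, if $K''\neq\emptyset$).
   Context: $C(K)$ is the Banach space of continuous functions $K\to\mathbb{K}$, where $\mathbb{K}=\mathbb{R}$ or $\mathbb{C}$, with the supremum norm. For a topological space $V$, $V'$ denotes the set of cluster (accumulation) points of $V$, and $K''=(K')'$. For a Banach space $X$, $B_X$ denotes its closed unit ball. $X$ has the weak-DD2P (weak diametral diameter two property) if for every non-empty relatively weakly open subset $W$ of $B_X$ there exists $x\in W$ such that $\sup_{y\in V}\|x-y\|=2$ for every relatively weakly open subset $V$ of $B_X$ with $x\in V$. *)

(* Defs.v *)
From HB Require Import structures.
From mathcomp Require Import all_boot all_order all_algebra.
From mathcomp Require Import complex.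
From mathcomp Require Import all_classical all_reals all_analysis.

Set Implicit Arguments.
Unset Strict Implicit.
Unset Printing Implicit Defensive.

Import Order.TTheory GRing.Theory Num.Theory.
Import numFieldNormedType.Exports.

Local Open Scope classical_set_scope.
Local Open Scope ring_scope.

Variant scalar_kind := RealScalars | ComplexScalars.

Definition scalars (R : realType) (k : scalar_kind) : numFieldType :=
  match k with RealScalars => R | ComplexScalars => R[i] end.

(* Norms in a normed module over [scalars R k] take values in [scalars R k].
   For complex scalars, the order is partial ([x <= y] forces ['Im x = 'Im y]),
   so the least upper bound of a non-empty set of non-negative elements is its
   supremum in [R], seen in [R[i]]. *)
Lemma norm_supremums (R : realType) (k : scalar_kind) (A : set (scalars R k)) :
  A !=set0 -> A `<=` [set x | 0 <= x] -> has_ubound A -> supremums A !=set0.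
Proof.
case: k A => /= A.
  by move=> A0 _ Ab; exists (sup A); split;
    [exact/ubP/ub_le_sup|move=> y Ay; exact: ge_sup].
move=> [a Aa] Ap [b Ab].
have Are z : A z -> z = (complex.Re z)%:C%C.
  by move=> /Ap /=; case: z => zr zi; rewrite lecE /= => /andP[/eqP -> _].
pose B := @complex.Re R @` A.
have Bub : has_ubound B.
  exists (complex.Re b) => _ [z Az <-].
  by move: (Ab _ Az); rewrite lecE => /andP[].
exists (sup B)%:C%C; split => [z Az|y Ay].
  by rewrite (Are _ Az) lecR; apply: ub_le_sup => //; exists z.
have yim : complex.Im y = 0.
  move: (Ay _ Aa); rewrite (Are _ Aa) lecE /= => /andP[/eqP + _].
  by [].
rewrite lecE /= yim eqxx /=; apply: ge_sup.
  by exists (complex.Re a), a.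
by move=> _ [z Az <-]; move: (Ay _ Az); rewrite lecE => /andP[].
Qed.

(* The proof that [K] is compact is a parameter of the type because the
   supremum norm is a norm only on bounded functions. *)
Definition contfun (R : realType) (k : scalar_kind) (K : topologicalType)
  (cK : compact [set: K]) : Type := continuousType K (scalars R k).

Section contfun_normed.
Context (R : realType) (k : scalar_kind) (K : topologicalType).
Variable cK : compact [set: K].
Local Notation F := (scalars R k).
Local Notation C := (contfun R k cK).

HB.instance Definition _ := Choice.on C.

Definition contfun_fun (f : C) : K -> F := f.

Lemma contfun_continuous (f : C) : continuous (contfun_fun f).
Proof. exact: cts_fun. Qed.

Definition contfun_zero : C :=
  mkcts (@cst_continuous K F 0).

Lemma contfun_opp_subproof (f : C) : continuous (fun x => - contfun_fun f x).
Proof. by move=> x; apply: continuousN; exact: contfun_continuous. Qed.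
Definition contfun_opp (f : C) : C := mkcts (@contfun_opp_subproof f).

Lemma contfun_add_subproof (f g : C) :
  continuous (fun x => contfun_fun f x + contfun_fun g x).
Proof. by move=> x; apply: continuousD; exact: contfun_continuous. Qed.
Definition contfun_add (f g : C) : C := mkcts (@contfun_add_subproof f g).

Lemma contfun_scale_subproof (a : F) (f : C) :
  continuous (fun x => a * contfun_fun f x).
Proof.
by move=> x; apply: continuousM; [exact: cst_continuous|exact: contfun_continuous].
Qed.
Definition contfun_scale (a : F) (f : C) : C :=
  mkcts (@contfun_scale_subproof a f).

Lemma contfunP (f g : C) : contfun_fun f =1 contfun_fun g -> f = g.
Proof. by move=> fg; apply/continuousEP. Qed.

Lemma contfun_addA : associative contfun_add.
Proof. by move=> f g h; apply: contfunP => x; exact: addrA. Qed.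
Lemma contfun_addC : commutative contfun_add.
Proof. by move=> f g; apply: contfunP => x; exact: addrC. Qed.
Lemma contfun_add0 : left_id contfun_zero contfun_add.
Proof. by move=> f; apply: contfunP => x; exact: add0r. Qed.
Lemma contfun_addN : left_inverse contfun_zero contfun_opp contfun_add.
Proof. by move=> f; apply: contfunP => x; exact: addNr. Qed.

HB.instance Definition _ := GRing.isZmodule.Build C
  contfun_addA contfun_addC contfun_add0 contfun_addN.

Lemma contfun_scaleA (a b : F) (f : C) :
  contfun_scale a (contfun_scale b f) = contfun_scale (a * b) f.
Proof. by apply: contfunP => x; exact: mulrA. Qed.
Lemma contfun_scale1 : left_id 1 contfun_scale.
Proof. by move=> f; apply: contfunP => x; exact: mul1r. Qed.
Lemma contfun_scaleDr : right_distributive contfun_scale +%R.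
Proof. by move=> a f g; apply: contfunP => x; exact: mulrDr. Qed.
Lemma contfun_scaleDl (f : C) : {morph contfun_scale^~ f : a b / a + b}.
Proof. by move=> a b; apply: contfunP => x; exact: mulrDl. Qed.

HB.instance Definition _ := GRing.Zmodule_isLmodule.Build F C
  contfun_scaleA contfun_scale1 contfun_scaleDr contfun_scaleDl.

Definition sup_norm (f : C) : F :=
  supremum 0 (range (fun x => `|contfun_fun f x|)).

Lemma contfun_bounded (f : C) : has_ubound (range (fun x => `|contfun_fun f x|)).
Proof.
have [M fM] : exists M : F, forall x, [set: K] x -> `|contfun_fun f x| <= M.
  suff /filter_ex : \forall M \near +oo, [set: K] `<=`
    [set x | `|contfun_fun f x| <= M] by [].
  move/compact_near_coveringP : cK => /(_ F (pinfty_nbhs F)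
    (fun M x => `|contfun_fun f x| <= M)); apply => x _.
  have fx : \forall y \near x, `|contfun_fun f y| <= `|contfun_fun f x| + 1.
    have /cvgrPdist_le/(_ 1 ltr01) := @contfun_continuous f x.
    apply: filterS => y fxy; rewrite -lerBlDl.
    by apply: le_trans (lerB_dist _ _) _; rewrite distrC.
  near=> y M => /=; apply: (@le_trans _ _ (`|contfun_fun f x| + 1)).
    by near: y.
  by near: M; apply: nbhs_pinfty_ge; rewrite realD ?normr_real ?real1.
by exists M => _ [x _ <-]; exact: fM.
Unshelve. all: by end_near. Qed.

Lemma sup_norm_supremums (f : C) :
  [set: K] !=set0 ->
  supremums (range (fun x => `|contfun_fun f x|)) (sup_norm f).
Proof.
move=> [x0 _].
have A0 : range (fun x => `|contfun_fun f x|) !=set0 by exists `|contfun_fun f x0|, x0.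
have [|s sA] := norm_supremums A0 _ (contfun_bounded f).
  by move=> _ [x _ <-]; exact: normr_ge0.
rewrite /sup_norm /supremum ifF; last by apply/negP => /eqP; exact/eqP/set0P.
by case: xgetP => // /(_ s).
Qed.

Lemma sup_norm_empty (f : C) : ~ ([set: K] !=set0) -> sup_norm f = 0.
Proof.
by move=> /set0P/negP/negPn/eqP K0; rewrite /sup_norm K0 image_set0 supremum0.
Qed.

Lemma le_sup_norm (f : C) (x : K) : `|contfun_fun f x| <= sup_norm f.
Proof.
have [+ _] := @sup_norm_supremums f (ex_intro _ x I).
by apply; exists x.
Qed.

Lemma sup_norm_le (f : C) (M : F) : 0 <= M ->
  (forall x, `|contfun_fun f x| <= M) -> sup_norm f <= M.
Proof.
move=> M0 fM; have [K0|/sup_norm_empty -> //] := pselect ([set: K] !=set0).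
by have [_] := sup_norm_supremums f K0; apply => _ [x _ <-]; exact: fM.
Qed.

Lemma sup_norm_ge0 (f : C) : 0 <= sup_norm f.
Proof.
have [[x _]|/sup_norm_empty -> //] := pselect ([set: K] !=set0).
by apply: le_trans (le_sup_norm f x).
Qed.

Lemma ler_sup_normD (f g : C) : sup_norm (f + g) <= sup_norm f + sup_norm g.
Proof.
apply: sup_norm_le => [|x]; first by rewrite addr_ge0 ?sup_norm_ge0.
apply: le_trans (ler_normD (contfun_fun f x) (contfun_fun g x)) _.
by rewrite lerD ?le_sup_norm.
Qed.

Lemma sup_normZ (a : F) (f : C) : sup_norm (a *: f) = `|a| * sup_norm f.
Proof.
have le (b : F) (g : C) : sup_norm (b *: g) <= `|b| * sup_norm g.
  apply: sup_norm_le => [|x]; first by rewrite mulr_ge0 ?sup_norm_ge0.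
  have -> : contfun_fun (b *: g) x = b * contfun_fun g x by [].
  by rewrite normrM ler_wpM2l ?le_sup_norm.
apply/eqP; rewrite eq_le le /=.
have [->|a0] := eqVneq a 0; first by rewrite normr0 mul0r sup_norm_ge0.
rewrite -ler_pdivlMl ?normr_gt0// -normfV.
by rewrite -{1}[f]scale1r -(mulVf a0) -scalerA le.
Qed.

Lemma sup_norm_eq0 (f : C) : sup_norm f = 0 -> f = 0.
Proof.
move=> f0; apply: contfunP => x; apply/eqP.
by rewrite -normr_le0 -f0; exact: le_sup_norm.
Qed.

HB.instance Definition _ := @Lmodule_isNormed.Build F C
  sup_norm ler_sup_normD sup_normZ sup_norm_eq0.

End contfun_normed.

Section weak_DD2P.
Context {F : numFieldType} (X : normedModType F).

Definition topological_dual := {f : {linear X -> F^o} | continuous f}.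

(* The coarsest topology on [X] making every element of the dual continuous. *)
Definition weak_space : topologicalType :=
  sup_topology (fun f : topological_dual =>
    Topological.on (initial_topology (sval f))).

Definition closed_unit_ball : set X := [set x | `|x| <= 1].

Definition relatively_weakly_open (W : set X) :=
  exists2 U : set weak_space, open U & W = U `&` closed_unit_ball.

(* For [F] one of the two [scalars R k], [norm_supremums] shows that the
   supremum below is an actual least upper bound, not the default value
   [0]. *)
Definition weak_DD2P := forall W : set X,
  relatively_weakly_open W -> W !=set0 ->
  exists2 x, W x & forall V : set X, relatively_weakly_open V -> V x ->
    supremum 0 [set `|x - y| | y in V] = 2.

End weak_DD2P.

(* For [A : set V], the cluster points of the subspace [A] are
   [derived_set A], [A] being coerced to a type with the subspace topology. *)
Definition derived_set (V : topologicalType) : set V := limit_point [set: V].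
Arguments derived_set V : clear implicits.

(* Main.v *)
Require Import Defs.
From HB Require Import structures.
From mathcomp Require Import all_boot all_order all_algebra finmap.
From mathcomp Require Import complex.
From mathcomp Require Import all_classical all_reals all_analysis.

Set Implicit Arguments.
Unset Strict Implicit.
Unset Printing Implicit Defensive.

Import Order.TTheory GRing.Theory Num.Theory.
Import numFieldNormedType.Exports.

Local Open Scope classical_set_scope.
Local Open Scope ring_scope.

(** An infinite subset of a compact space has a limit point, and a set with a
    limit point in a Hausdorff space is infinite; applied to the closed set
    [K'], this gives the equivalence between the infinity of [K'] and the
    existence of a point in [K''].

    The bounded functions [h_n] on [K] with disjoint supports tend weakly to
    [0]: for a functional [f] and unimodular scalars [c_n] such that
    [c_n * f (h_n) = |f (h_n)|], every finite sum of the [|f (h_n)|] is the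
    value of [f] at a function whose norm does not exceed the common bound of
    the [h_n] ([dual_cvg0_disjoint]). This avoids any representation of the dual
    of [C(K)] by measures. Near a limit point [t] of a set [A] there are
    infinitely many disjoint open sets that meet [A], and on each of them a
    function [x] of the unit ball can be modified, within the ball, so as to
    take a prescribed value [c], [|c| <= 1], at a point of [A]. Hence some of
    these modifications lie in any given weak neighbourhood of [x]
    ([weakly_open_prescribed_value]).

    Suppose that [K'] is infinite. Using this with [A = K'] and [c = 1], any
    non-empty relatively weakly open [W] contains an [x] equal to [1] at some
    point [t] of [K']. Using it again at [t], with [A = K] and [c = -1], any
    weak neighbourhood of [x] in the ball contains a [y] equal to [-1] at a
    point where [x] is close to [1], so that [|x - y|] is close to [2].

    Suppose that [K'] is finite. The functions of the ball smaller than [1/4] on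
    [K'] form a non-empty relatively weakly open set [W]. For [x] in [W], the
    set [S] where [|x|] is at least [1/4] has no limit point, so it is finite,
    and the [y] of the ball that are [1/4]-close to [x] on [S] form a weak
    neighbourhood of [x] whose points are at distance at most [5/4] from [x]. *)

(** * Limit points in compact and in Hausdorff spaces *)

(** The subsets of [T] containing all but finitely many points of [A] form a
    proper filter, of which any cluster point is a limit point of [A]. *)
Lemma compact_infinite_limit_point (T : topologicalType) (A : set T) :
  compact [set: T] -> infinite_set A -> limit_point A !=set0.
Proof.
move=> cT infA; pose F : set_system T := [set B | finite_set (A `\` B)].
have FF : ProperFilter F.
  split; first by rewrite /F/= setD0.
  split; first by rewrite /F/= setDT; exact: finite_set0.
  - by move=> B C FB FC; rewrite /F/= setDIr finite_setU.
  - by move=> B C BC; apply: sub_finite_set => x [Ax nCx]; split => // /BC.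
have [t [_ Ft]] := cT F FF filterT.
exists t => U tU.
have FAt : F (A `\ t).
  by apply: (sub_finite_set _ (finite_set1 t)) => x [Ax nAx];
    apply: contrapT => xt; apply: nAx.
have [y [[Ay yt] Uy]] := Ft _ _ FAt tU.
by exists y; split => //; exact/eqP.
Qed.

Lemma limit_point_infinite (T : topologicalType) (A : set T) :
  hausdorff_space T -> limit_point A !=set0 -> infinite_set A.
Proof.
move=> hT [t tA] finA.
have clA : closed (A `\ t).
  apply: (accessible_finite_set_closed.1 (hausdorff_accessible hT)).
  exact: finite_setD.
have /tA[y [yt Ay nAy]] : nbhs t (~` (A `\ t)).
  by apply: open_nbhs_nbhs; split; [exact: closed_openC|move=> [_]; exact].
by apply: nAy; split => //; exact/eqP.
Qed.

Lemma derived_set_type (T : topologicalType) (A : set T) :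
  derived_set (set_type A) !=set0 <-> A `&` limit_point A !=set0.
Proof.
split=> [[p pA]|[t [At tA]]].
  exists (val p); split; first exact: set_valP.
  move=> U pU; have /pA[q [qp _ Uq]] : nbhs p (val @^-1` U).
    exact: (@initial_continuous _ _ (val : set_type A -> T) p).
  by exists (val q); split => //; exact: set_valP.
exists (SigSub (mem_set At)) => U [_ [[V oV <-] Vt VU]].
have /tA[y [yt Ay Vy]] : nbhs t V by apply: open_nbhs_nbhs; split.
by exists (SigSub (mem_set Ay)); split => //; exact: VU.
Qed.

(** Each step picks a point [a] of [A] in the current neighbourhood [M] of [t],
    separates it from [t], and passes to a smaller neighbourhood of [t] that is
    disjoint from the open set chosen around [a]. *)
Lemma limit_point_disjoint_opens (T : topologicalType) (A N : set T) (t : T) :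
  hausdorff_space T -> limit_point A t -> nbhs t N ->
  exists (a : nat -> T) (O : nat -> set T),
    [/\ forall n, A (a n) /\ N (a n), forall n, open (O n) /\ O n (a n) &
        forall i j, i != j -> O i `&` O j = set0].
Proof.
move=> hT tA tN.
have step (M : set T) : exists q : T * set T * set T, nbhs t M ->
    [/\ A q.1.1, M q.1.1 /\ q.1.2 q.1.1, open q.1.2 /\ q.1.2 `<=` M,
        nbhs t q.2 /\ q.2 `<=` M & q.1.2 `&` q.2 = set0].
  have [tM|ntM] := pselect (nbhs t M); last by exists (t, set0, set0).
  have /tA[a [at_ Aa Ma]] : nbhs t M° by exact: nbhs_interior.
  move: hT; rewrite open_hausdorff => /(_ _ _ at_)[[P Q] /= [aP tQ]].
  move=> [oP oQ /eqP PQ].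
  exists (a, P `&` M°, Q `&` M) => _ /=; split => //.
  - by split; [exact: interior_subset|split => //; exact: set_mem].
  - split; first by apply: openI => //; exact: open_interior.
    by move=> x [_ /interior_subset].
  - split; last by move=> x [].
    by apply: filterI => //; apply: open_nbhs_nbhs; split => //; exact: set_mem.
  - by rewrite -subset0 -PQ => x [[Px _] [Qx _]].
have [g gP] := choice step.
pose M n := iter n (fun M => (g M).2) N.
have tM n : nbhs t (M n) by elim: n => //= n /gP[_ _ _ []].
have M_sub i j : (i <= j)%N -> M j `<=` M i.
  move=> /subnK <-; elim: (j - i)%N => // n IHn.
  rewrite addSn /=; apply: subset_trans IHn.
  by have [_ _ _ []] := gP _ (tM (n + i)%N).
exists (fun n => (g (M n)).1.1), (fun n => (g (M n)).1.2); split => [n|n|].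
- by have [? [? _] _ _ _] := gP _ (tM n); split => //; exact: (M_sub 0 n).
- by have [_ [_ ?] [? _] _ _] := gP _ (tM n).
suff disj i j : (i < j)%N -> (g (M i)).1.2 `&` (g (M j)).1.2 = set0.
  move=> i j; case: ltngtP => // ij _; first exact: disj.
  by rewrite setIC; exact: disj.
move=> ij; have [_ _ _ _ OM0] := gP _ (tM i).
have [_ _ [_ OM] _ _] := gP _ (tM j).
by rewrite -subset0 -OM0 => x [Oix /OM Mjx]; split => //; exact: (M_sub _ _ ij).
Qed.

(** * Real and complex scalars *)

Lemma scalars_archimedean (R : realType) (k : scalar_kind) (x : scalars R k) :
  0 <= x -> exists n : nat, x < n%:R.
Proof.
case: k x => /= [x x0|[a b]].
  by exists (Num.truncn x).+1; rewrite -Num.Theory.truncn_lt_nat.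
rewrite lecE /= => /andP[/eqP -> a0].
exists (Num.truncn a).+1; rewrite -(rmorph_nat (real_complex R)) ltcR.
by rewrite -Num.Theory.truncn_lt_nat.
Qed.

Lemma scalars_urysohn (R : realType) (k : scalar_kind) (K : topologicalType)
  (cK : compact [set: K]) (hK : hausdorff_space K) (a : K) (O : set K) :
  open O -> O a ->
  exists phi : contfun R k cK, [/\ contfun_fun phi a = 1,
    forall t, ~ O t -> contfun_fun phi t = 0 &
    forall t, 0 <= contfun_fun phi t <= 1].
Proof.
move=> oO Oa.
have [f [cf f01 fO fa]] : exists f : K -> R, [/\ continuous f,
    forall t, 0 <= f t <= 1, forall t, ~ O t -> f t = 0 & f a = 1].
  have /(@normal_separatorP R) sepK := compact_normal hK cK.
  have cla : closed [set a].
    exact: (accessible_closed_set1 (hausdorff_accessible hK)).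
  have Oa0 : ~` O `&` [set a] = set0.
    by rewrite -subset0 => x [nOx xa]; apply: nOx; rewrite xa.
  have /(@uniform_separatorP _ R)[f [cf f01 f0 f1]] :=
    sepK _ _ (open_closedC oO) cla Oa0.
  exists f; split => //.
  - by move=> t; have /f01 := imageT f t; rewrite /= in_itv.
  - by move=> t nOt; apply: f0; exists t.
  - by apply: f1; exists a.
have [g [cg g0 g1 gle]] : exists g : R -> scalars R k,
    [/\ continuous g, g 0 = 0, g 1 = 1 &
      forall x, 0 <= x <= 1 -> 0 <= g x <= 1].
  case: k => /=; first by exists id; split => // x; exact: cvg_id.
  exists (real_complex R); split => //.
  - move=> x; apply/cvgrPdist_lt => -[e e'] /=.
    rewrite ltcE /= => /andP[/eqP -> e0].
    have /cvgrPdist_lt/(_ e e0) := @cvg_id _ (nbhs x).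
    by apply: filterS => y; rewrite -rmorphB/= normc_def/= expr0n/= addr0
      sqrtr_sqr ltcR.
  - move=> x.
    by rewrite -(rmorph0 (real_complex R)) -(rmorph1 (real_complex R)) !lecR.
have cgf : continuous (g \o f).
  by move=> t; apply: continuous_comp; [exact: cf|exact: cg].
exists (mkcts cgf : contfun R k cK); split.
- by rewrite -[LHS]/(g (f a)) fa.
- by move=> t nOt; rewrite -[LHS]/(g (f t)) fO.
- by move=> t; exact/gle/f01.
Qed.

(** * Weakly null sequences of functions with disjoint supports *)

Section contfun_weak.
Context (R : realType) (k : scalar_kind) (K : topologicalType).
Context (cK : compact [set: K]).
Local Notation F := (scalars R k).
Local Notation C := (contfun R k cK).
Local Notation "f .@ t" := (contfun_fun f t) (at level 2, format "f .@ t").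

Lemma contfun_sum (I : Type) (s : seq I) (h : I -> C) (t : K) :
  (\sum_(i <- s) h i).@t = \sum_(i <- s) (h i).@t.
Proof. exact: (big_morph (fun g : C => g.@t)). Qed.

Lemma contfun_scaleE (a : F) (f : C) (t : K) : (a *: f).@t = a * f.@t.
Proof. by []. Qed.

(** If [|f (h n)| >= e] for [m] indices [n], then [e * m] is at most the norm of
    [f] times [M], because some unimodular combination of these [h n] has norm
    at most [M] and is sent by [f] to the sum of the [|f (h n)|]. *)
Lemma dual_cvg0_disjoint (f : topological_dual C) (h : nat -> C) (M : F) :
  (forall n t, `|(h n).@t| <= M) ->
  (forall i j t, i != j -> (h i).@t = 0 \/ (h j).@t = 0) ->
  sval f (h n) @[n --> \oo] --> (0 : F).
Proof.
move=> hM hdisj.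
have [[t0 _]|K0] := pselect ([set: K] !=set0); last first.
  have h0 n : h n = 0 by apply: contfunP => t; case: K0; exists t.
  rewrite (_ : (fun n => _) = fun=> 0); first exact: cvg_cst.
  by apply/funext => n; rewrite h0 linear0.
have M0 : 0 <= M by apply: le_trans (hM 0 t0).
case: f => f /= cf.
have [r r0 fr] : exists2 r : F, 0 < r & forall x : C, `|f x| <= r * `|x|.
  by have /linear_boundedP/pinfty_ex_gt0[r r0 ?] :=
    (linear_bounded_continuous f).2 cf; exists r.
apply/cvgrPdist_lt => e e0.
have finD : finite_set [set n | e <= `|f (h n)|].
  apply: contrapT => infD.
  have [m rMm] : exists m : nat, r * M / e < m%:R.
    by apply: scalars_archimedean; rewrite divr_ge0 ?mulr_ge0// ltW.
  have [B BD mB] := infinite_set_fset m infD.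
  (* [c n] is the sign that makes the terms [f (h n)] add up; it has modulus 1,
     or is 0 when [f (h n)] is. *)
  pose c n : F := `|f (h n)| / f (h n).
  pose g : C := \sum_(n <- B) c n *: h n.
  have gM : `|g| <= M.
    apply: sup_norm_le => // t; rewrite contfun_sum.
    have ch n : `|(c n *: h n).@t| <= M.
      rewrite contfun_scaleE normrM -[leRHS]mul1r ler_pM//.
      rewrite normrM normr_id normfV.
      have [->|fh0] := eqVneq (f (h n)) 0; first by rewrite normr0 mul0r ler01.
      by rewrite mulfV ?normr_eq0.
    (* By disjointness, at most one term of the sum is non-zero at [t]. *)
    have [[n [nB hn0]]|nB] :=
      pselect (exists n, n \in B /\ (h n).@t != 0).
      have rest0 : \sum_(i <- (B `\ n)%fset) (c i *: h i).@t = 0.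
        rewrite big_seq big1// => i; rewrite !inE => /andP[ni _].
        rewrite contfun_scaleE.
        have [->|/eqP] := hdisj _ _ t ni; first by rewrite mulr0.
        by rewrite (negbTE hn0).
      have -> : \sum_(i <- B) (c i *: h i).@t = (c n *: h n).@t + 0.
        by rewrite -[X in _ = _ + X]rest0 (big_fsetD1 n nB).
      by rewrite addr0; exact: ch.
    rewrite big_seq big1 ?normr0// => i iB; rewrite contfun_scaleE.
    have [->|hi0] := eqVneq (h i).@t 0; first by rewrite mulr0.
    by case: nB; exists i.
  have fg : f g = \sum_(n <- B) `|f (h n)|.
    rewrite linear_sum; apply: eq_bigr => n _.
    rewrite linearZ/= -[LHS]/(c n * f (h n)) /c.
    have [->|fh0] := eqVneq (f (h n)) 0; first by rewrite normr0 mulr0.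
    by rewrite mulfVK.
  have : e * m%:R <= r * M.
    apply: (@le_trans _ _ (\sum_(n <- B) e)).
      rewrite big_const_seq count_predT iter_addr_0 -[leRHS]mulr_natr.
      by rewrite ler_pM2l// ler_nat.
    apply: (@le_trans _ _ (f g)).
      by rewrite fg big_seq [leRHS]big_seq ler_sum// => n /BD.
    apply: le_trans (_ : `|f g| <= _).
      by rewrite fg [leRHS]ger0_norm// sumr_ge0.
    by apply: le_trans (fr g) _; rewrite ler_pM2l.
  by rewrite mulrC -ler_pdivlMr// => /le_lt_trans/(_ rMm); rewrite ltxx.
have : \forall n \near \oo, ~ [set n | e <= `|f (h n)|] n.
  have : \forall n \near \oo, (\bigcap_(i in [set` fset_set
      [set n | e <= `|f (h n)|]]) [set n | n != i]) n.
    apply: filter_bigI => i _; near=> n.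
    by rewrite /= gt_eqF// ltEnat; near: n; exact: nbhs_infty_gt.
  rewrite fset_setK//; apply: filterS => n nD Dn.
  by have /= := nD n Dn; rewrite eqxx.
apply: filterS => n /= /negP nfh; rewrite sub0r normrN.
by rewrite real_ltNge// ?normr_real// gtr0_real.
Unshelve. all: by end_near. Qed.


Lemma contfunDE (f g : C) (t : K) : (f + g).@t = f.@t + g.@t.
Proof. by []. Qed.

Lemma contfunBE (f g : C) (t : K) : (f - g).@t = f.@t - g.@t.
Proof. by []. Qed.

Lemma ball_le1 (x : C) (t : K) : closed_unit_ball x -> `|x.@t| <= 1.
Proof. by apply: le_trans; exact: le_sup_norm. Qed.

Lemma weak_nbhs_disjoint_perturbation (x : C) (h : nat -> C) (M : F)
    (U : set (weak_space C)) :
  (forall n t, `|(h n).@t| <= M) ->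
  (forall i j t, i != j -> (h i).@t = 0 \/ (h j).@t = 0) ->
  open U -> U x -> \forall n \near \oo, U (x + h n).
Proof.
move=> hM hdisj oU Ux.
have : (x + h n) @[n --> \oo] --> (x : weak_space C).
  apply/cvg_sup => f A [_ [[V oV <-] Vfx] VA].
  have : sval f (x + h n) @[n --> \oo] --> (sval f x : F).
    rewrite -[X in _ --> X]addr0.
    under eq_fun do rewrite linearD.
    by apply: cvgD; [exact: cvg_cst|exact: (dual_cvg0_disjoint f hM hdisj)].
  move=> /(_ V (open_nbhs_nbhs (conj oV Vfx))).
  by rewrite !nbhs_filterE /fmap/=; apply: filterS => n; exact: VA.
by apply; apply: open_nbhs_nbhs.
Qed.

(** * Prescribing a value inside a weak neighbourhood *)

Context (hK : hausdorff_space K).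

(** [x + h] is the convex combination [(1 - phi) * x + phi * c] for a Urysohn
    function [phi] equal to [1] at [a] and to [0] outside [O]: this keeps it in
    the unit ball. *)
Lemma local_modification (x : C) (c : F) (a : K) (O : set K) :
  closed_unit_ball x -> `|c| <= 1 -> open O -> O a ->
  exists h : C, [/\ (x + h).@a = c, forall t, ~ O t -> h.@t = 0,
    closed_unit_ball (x + h) & forall t, `|h.@t| <= 2].
Proof.
move=> x1 c1 oO Oa.
have [phi [phia phi0 phi01]] := scalars_urysohn R k cK hK oO Oa.
have ch : continuous (fun t => phi.@t * (c - x.@t)).
  move=> t; apply: continuousM; first exact: contfun_continuous.
  by apply: continuousB; [exact: cst_continuous|exact: contfun_continuous].
pose h : C := mkcts ch; have hE t : h.@t = phi.@t * (c - x.@t) by [].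
exists h; split.
- by rewrite contfunDE hE phia mul1r addrC subrK.
- by move=> t nOt; rewrite hE phi0// mul0r.
- apply: sup_norm_le => // t; rewrite contfunDE hE.
  have /andP[p0 p1] := phi01 t.
  have -> : x.@t + phi.@t * (c - x.@t) = (1 - phi.@t) * x.@t + phi.@t * c.
    by rewrite mulrBr mulrBl mul1r addrA addrAC.
  apply: le_trans (ler_normD _ _) _; rewrite !normrM.
  rewrite (ger0_norm p0) ger0_norm ?subr_ge0//.
  rewrite -[leRHS](subrK phi.@t); apply: lerD.
    by rewrite -[leRHS]mulr1 ler_wpM2l ?subr_ge0// ball_le1.
  by rewrite -[leRHS]mulr1 ler_wpM2l.
- move=> t; rewrite hE normrM; have /andP[p0 p1] := phi01 t.
  rewrite (ger0_norm p0) -[leRHS]mul1r ler_pM// (le_trans (ler_normB _ _))//.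
  by rewrite -[2]/(1 + 1) lerD// ball_le1.
Qed.

(** Modifications of [x] on disjoint open sets that meet [A] inside [N] tend
    weakly to [x], so one of them lies in [V]. *)
Lemma weakly_open_prescribed_value (V : set C) (A N : set K) (x : C) (t : K)
    (c : F) :
  relatively_weakly_open V -> V x -> limit_point A t -> nbhs t N ->
  `|c| <= 1 -> exists (y : C) (a : K), [/\ V y, A a, N a & y.@a = c].
Proof.
move=> [U oU ->] [Ux x1] tA tN c1.
have [a [G [aAN aG Gdisj]]] := limit_point_disjoint_opens hK tA tN.
have /choice[h hP] := fun n => local_modification x1 c1 (aG n).1 (aG n).2.
have hM n t' : `|(h n).@t'| <= 2 by have [_ _ _] := hP n; apply.
have hdisj i j t' : i != j -> (h i).@t' = 0 \/ (h j).@t' = 0.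
  move=> /Gdisj Gij; have [_ hi _ _] := hP i; have [_ hj _ _] := hP j.
  have [Gi|/hi] := pselect (G i t'); last by left.
  have [Gj|/hj] := pselect (G j t'); last by right.
  by exfalso; have : (G i `&` G j) t' by []; rewrite Gij.
have /filter_ex[n Un] := weak_nbhs_disjoint_perturbation hM hdisj oU Ux.
by exists (x + h n), (a n); have [? _ ? _] := hP n; have [? ?] := aAN n.
Qed.

(** * Weak neighbourhoods given by finitely many evaluations *)

Definition evaluation (t : K) (f : C) : F^o := f.@t.

Lemma evaluation_linear (t : K) : linear (evaluation t).
Proof. by []. Qed.

HB.instance Definition _ (t : K) :=
  GRing.isLinear.Build F C F^o *:%R (evaluation t) (evaluation_linear t).

Lemma evaluation_continuous (t : K) : continuous (evaluation t).
Proof.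
apply/linear_bounded_continuous/linear_boundedP.
near=> r => f; apply: (le_trans (le_sup_norm f t)).
rewrite -[leLHS]mul1r; apply: ler_wpM2r; first exact: sup_norm_ge0.
by near: r; exact: nbhs_pinfty_ge.
Unshelve. all: by end_near. Qed.

Lemma evaluation_weakly_continuous (t : K) :
  continuous (evaluation t : weak_space C -> F).
Proof.
move=> y.
pose f : topological_dual C :=
  exist _ (evaluation t : {linear C -> F^o}) (@evaluation_continuous t).
have /cvg_sup/(_ f) : nbhs (y : weak_space C) --> (y : weak_space C) by [].
move=> yy; apply: cvg_trans (@initial_continuous _ _ (sval f) y).
by move=> A fA; apply: yy.
Qed.

Lemma weak_nbhs_evaluation (x y : C) (t : K) (e : F) :
  `|x.@t - y.@t| < e ->
  nbhs (y : weak_space C) [set z : C | `|x.@t - z.@t| < e].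
Proof.
move=> xye; have e0 : 0 < e - `|x.@t - y.@t| by rewrite subr_gt0.
have /cvgrPdist_lt/(_ _ e0) := @evaluation_weakly_continuous t y.
apply: filterS => z yz /=; rewrite -(subrKA y.@t).
by apply: le_lt_trans (ler_normD _ _) _; rewrite addrC -ltrBrDr.
Qed.

Definition ball_near_on (S : set K) (x : C) (e : F) : set C :=
  [set y | closed_unit_ball y /\ forall t, S t -> `|x.@t - y.@t| < e].

Lemma weakly_open_ball_near_on (S : set K) (x : C) (e : F) :
  finite_set S -> relatively_weakly_open (ball_near_on S x e).
Proof.
move=> finS.
exists (\bigcap_(t in S) [set y : C | `|x.@t - y.@t| < e]); last first.
  by apply/seteqP; split => y []; split.
rewrite openE => y Sy; rewrite /interior -(fset_setK finS).
apply: filter_bigI => t; rewrite in_fset_set// inE => /Sy.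
exact: weak_nbhs_evaluation.
Qed.

(** * The diametral diameter two property *)

Lemma supremum_unique (A : set F) (s : F) :
  A !=set0 -> supremums A s -> supremum 0 A = s.
Proof.
move=> /set0P/negbTE A0 As; rewrite /supremum A0.
by apply: xget_subset1 => //; exact: is_subset1_supremums.
Qed.

(** If [K'] is finite, every function of the ball that is small on [K'] has a
    weak neighbourhood in the ball within distance [5/4] of it: away from a
    neighbourhood of [K'] there are only finitely many points, and closeness at
    finitely many points is a weakly open condition. *)
Lemma weak_DD2P_infinite : weak_DD2P C -> infinite_set (derived_set K).
Proof.
move=> DD finK'; have q0 : (0 : F) < 4^-1 by rewrite invr_gt0 ltr0n.
have B0 : closed_unit_ball (0 : C) by rewrite /closed_unit_ball/= normr0 ler01.
have [||x [x1 xK'] supx] := DD (ball_near_on (derived_set K) 0 4^-1).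
- exact: weakly_open_ball_near_on.
- by exists 0; split => // t _; rewrite subrr normr0.
pose S := [set t | ~ `|x.@t| < 4^-1].
(* A limit point of [S] would belong to [K'], near which [|x| < 1/4]. *)
have finS : finite_set S.
  apply: contrapT => /(compact_infinite_limit_point cK)[t tS].
  have tK' : derived_set K t by move=> U /tS[y [? _ ?]]; exists y.
  have xt : `|x.@t| < 4^-1 by have := xK' t tK'; rewrite sub0r normrN.
  have /tS[s [_ nGs Gs]] : nbhs t [set s | `|x.@s| < 4^-1].
    exact: (cvgr_norm_lt _ (@contfun_continuous _ _ _ _ x t)).
  exact: nGs.
pose V := ball_near_on S x 4^-1.
have Vx : V x by split => // t _; rewrite subrr normr0.
have D0 : [set `|x - y| | y in V] !=set0 by exists `|x - x|, x.
(* On [S], [|x - y| < 1/4]; elsewhere [|x| < 1/4] and [|y| <= 1]. *)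
have DM : ubound [set `|x - y| | y in V] (1 + 4^-1).
  move=> _ [y [y1 yS] <-].
  apply: sup_norm_le => [|t]; first by rewrite addr_ge0 // ltW.
  rewrite contfunBE; have [St|/contrapT xt] := pselect (S t).
    by rewrite (le_trans (ltW (yS t St)))// lerDr.
  rewrite (le_trans (ler_normB _ _))// addrC lerD ?ball_le1//.
  exact: ltW.
have [||s sD] := @norm_supremums R k _ D0; [|by exists (1 + 4^-1)|].
  by move=> _ [y _ <-]; exact: normr_ge0.
have := supx V (weakly_open_ball_near_on _ _ finS) Vx.
rewrite (supremum_unique D0 sD) => s2; move: sD.2 => /(_ _ DM).
rewrite s2 -[2]/(1 + 1) lerD2l -[leRHS]div1r ler_pdivlMr ?ltr0n//.
by rewrite mul1r lern1.
Qed.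

(** The diametral point [x] takes the value [1] at a non-isolated point [t];
    values [-1] can then be prescribed at points close to [t]. *)
Lemma infinite_weak_DD2P : infinite_set (derived_set K) -> weak_DD2P C.
Proof.
move=> /(compact_infinite_limit_point cK)[t0 t0K'] W oW [x0 Wx0].
have n1 : `|1 : F| <= 1 by rewrite normr1.
have [x [t [Wx tK' _ xt]]] :=
  weakly_open_prescribed_value oW Wx0 t0K' filterT n1.
have B1 (V : set C) : relatively_weakly_open V -> V `<=` @closed_unit_ball _ C.
  by move=> [U _ ->] y [].
exists x => // V oV Vx; have x1 := B1 _ oV _ Vx.
apply: supremum_unique; first by exists `|x - x|, x.
split=> [_ [y /(B1 _ oV) y1 <-]|u uD].
  by apply: le_trans (ler_normB _ _) _; rewrite -[2]/(1 + 1) lerD.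
have u0 : 0 <= u by apply: le_trans (uD `|x - x| _) => //; exists x.
rewrite real_leNgt ?ger0_real//; apply/negP => u2.
have e0 : 0 < 2 - u by rewrite subr_gt0.
have tN : nbhs t [set s | `|x.@t - x.@s| < 2 - u].
  by have /cvgrPdist_lt/(_ _ e0) := @contfun_continuous _ _ _ _ x t.
have nN1 : `|-1 : F| <= 1 by rewrite normrN1.
have [y [a [Vy _ /= xa ya]]] := weakly_open_prescribed_value oV Vx tK' tN nN1.
have xyu : `|x.@a + 1| <= u.
  apply: le_trans (uD `|x - y| _); last by exists y.
  by apply: le_trans (le_sup_norm (x - y) a); rewrite contfunBE ya opprK.
suff : 2 < 2 :> F by rewrite ltxx.
rewrite -[ltRHS](subrK u).
apply: (@le_lt_trans _ _ (`|x.@t - x.@a| + `|x.@a + 1|)); last exact: ltr_leD.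
have -> : 2 = `|(x.@t - x.@a) + (x.@a + 1)| :> F.
  by rewrite addrA subrK xt ger0_norm // ler0n.
exact: ler_normD.
Qed.

End contfun_weak.

Theorem proposition2p1 (R : realType) (k : scalar_kind) (K : topologicalType)
  (cK : compact [set: K]) (hK : hausdorff_space K) :
  (weak_DD2P (contfun R k cK) <-> infinite_set (derived_set K)) /\
  (infinite_set (derived_set K) <->
   derived_set (set_type (derived_set K)) !=set0).
Proof.
split; first by split; [exact: weak_DD2P_infinite|exact: infinite_weak_DD2P].
split=> [/(compact_infinite_limit_point cK)[t tK']|].
  apply/derived_set_type; exists t; split => //.
  have := limit_point_closed [set: K] (hausdorff_accessible hK).
  by apply; exact: subset_limit_point.
move=> /derived_set_type[t [_ tK']].
by apply: limit_point_infinite => //; exists t.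
Qed.
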